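(* Let $B$ be a commutative Bézout domain and let $M_V$ be a model of $T_{B,V,div}$, i.e. a $B$-module $M$ expanded by the predicates $V_\delta(M)=Ma$ for $\delta=v(a)\in\Gamma(B)^+$, $a\in B\setminus\{0\}$. Let $\phi(\mathbf y)$ be a positive primitive (pp) $\mathcal L_{B,V}$-formula. Then there are a finite set $K$, a finite covering of $MSpec(B)$ by constructible subsets $C_{\phi,k}$ ($k\in K$), and for each $k\in K$ a conjunction $\psi_k(\mathbf y)$ of atomic $\mathcal L_{B_{\mathcal M},V}$-formulas (for $\mathcal M\in C_{\phi,k}$) such that for every tuple $\mathbf u$ of elements of $M$, $$M_V\models\phi(\mathbf u)\iff \bigwedge_{k\in K}\Big(\text{for all }\mathcal M\in C_{\phi,k},\ (M_{\mathcal M})_V\models\psi_k(\mathbf u_{\mathcal M})\Big),$$ where $\mathbf u_{\mathcal M}$ denotes the image of the tuple $\mathbf u$ in the localization $M_{\mathcal M}$.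
   Context: Rings are commutative integral domains with $1$; $B$ is Bézout if every finitely generated ideal is principal. $Q(B)$ is the fraction field, $U$ the group of units of $B$, and $\Gamma(B)=Q(B)^\times/U$ the group of divisibility, (lattice-)ordered by $aU\le bU$ iff $ba^{-1}\in B$; its positive part is $\Gamma(B)^+=\{aU: a\in B\setminus\{0\}\}$, and $v(a)=aU$. $MSpec(B)$ is the set of maximal ideals of $B$; its basic closed sets are $V(a)=\{\mathcal M\in MSpec(B): a\in\mathcal M\}$, $a\in B$, and the constructible subsets are the elements of the Boolean algebra generated by the sets $V(a)$. For $\mathcal M\in MSpec(B)$, $B_{\mathcal M}$ is the localization (a valuation domain), $\Gamma(B_{\mathcal M})$ is its value group, $v_{\mathcal M}$ its valuation, and $\delta_{\mathcal M}$ is the image in $\Gamma(B_{\mathcal M})$ of $\delta\in\Gamma(B)$. $M_{\mathcal M}=M\otimes_B B_{\mathcal M}$ is the localization of $M$. For a Bézout domain $R$, $\mathcal L_R=\{+,-,0,\cdot a: a\in R\}$ is the language of $R$-modules and $\mathcal L_{R,V}=\mathcal L_R\cup\{V_\delta:\delta\in\Gamma(R)^+\}$ with unary predicates $V_\delta$. The theory $T_{R,V,div}$ consists of the theory of $R$-modules together with: (1) $V_\delta(0)$; (2) $V_{\delta_1}(m_1)\wedge V_{\delta_2}(m_2)\to V_{\delta_1\wedge\delta_2}(m_1+m_2)$; (3) $V_\delta(m)\to V_{\delta\wedge\mu}(m)$; (4) $V_\delta(m)\to V_{\delta\cdot v(a)}(ma)$ for $a\in R\setminus\{0\}$; (5)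 $\forall m\,V_1(m)$; (6) $V_{v(a)}(m)\to\exists n\,(na=m)$ for $a\in R\setminus\{0\}$ (for all $\delta,\delta_i,\mu\in\Gamma(R)^+$). Equivalently, a model is an $R$-module $N$ with $V_{v(a)}(N)=Na$ for every $a\in R\setminus\{0\}$. In $(M_{\mathcal M})_V$ the predicates are interpreted in this way for the $B_{\mathcal M}$-module $M_{\mathcal M}$: $V_\delta(M_{\mathcal M})=M_{\mathcal M}a$ whenever $\delta=v_{\mathcal M}(a)$. A pp formula is one of the form $\exists\mathbf x\,\theta(\mathbf x,\mathbf y)$ with $\theta$ a conjunction of atomic formulas. That $\psi_k$ is a single conjunction of atomic $\mathcal L_{B_{\mathcal M},V}$-formulas over $C_{\phi,k}$ means: its scalars are elements of $Q(B)$ that lie in $B_{\mathcal M}$ for every $\mathcal M\in C_{\phi,k}$, and its predicates are $V_\delta$ with $\delta\in\Gamma(B)$ such that $\delta_{\mathcal M}\in\Gamma(B_{\mathcal M})^+$ for every $\mathcal M\in C_{\phi,k}$, $V_\delta$ being read as $V_{\delta_{\mathcal M}}$ in $B_{\mathcal M}$-modules. *)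

(* Defs.v *)
From HB Require Import structures.
From mathcomp Require Import all_boot all_algebra.
From mathcomp Require Import boolp classical_sets.
From mathcomp Require Import ring.

Set Implicit Arguments.
Unset Strict Implicit.
Unset Printing Implicit Defensive.

Import GRing.Theory.

Local Open Scope quotient_scope.
Local Open Scope classical_set_scope.
Local Open Scope ring_scope.

Notation "x %:F" := (@FracField.tofrac _ x).

Definition fg_ideal (B : idomainType) (s : seq B) : set B :=
  [set x | exists c : 'I_(size s) -> B, x = \sum_(i < size s) c i * s`_i].

Definition principal_ideal (B : idomainType) (d : B) : set B :=
  [set x | exists c, x = c * d].

Definition bezout_domain (B : idomainType) : Prop :=
  forall s : seq B, exists d : B, fg_ideal s = principal_ideal d.

(* [idealr_closed] includes the condition that the ideal is proper *)
Definition maximal_ideal (B : idomainType) (I : {pred B}) : Prop :=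
  idealr_closed I /\
  forall J : {pred B}, idealr_closed J -> {subset I <= J} -> {subset J <= I}.

Record MSpec (B : idomainType) := MkMSpec {
  mspec_ideal : B -> bool;
  mspecP : maximal_ideal mspec_ideal }.

Canonical MSpec_predType (B : idomainType) :=
  PredType (@mspec_ideal B).

Definition Vset (B : idomainType) (a : B) : set (MSpec B) := [set m : MSpec B | a \in m].

Inductive constructible (B : idomainType) : set (MSpec B) -> Prop :=
| constructible_V a : constructible (Vset a)
| constructible_C C of constructible C : constructible (~` C)
| constructible_I C D of constructible C & constructible D :
    constructible (C `&` D)
| constructible_U C D of constructible C & constructible D :
    constructible (C `|` D).

Section MaximalIdeal.
Variables (B : idomainType) (m : MSpec B).

Lemma mspec_one : 1 \notin m.
Proof. by case: (mspecP m) => -[]. Qed.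

Lemma mspec_zero : 0 \in m.
Proof. by case: (mspecP m) => -[]. Qed.

Lemma mspec_lin a u v : u \in m -> v \in m -> a * u + v \in m.
Proof. by case: (mspecP m) => -[_ _ h] _; exact: h. Qed.

Lemma mspec_mull a u : u \in m -> a * u \in m.
Proof. by move=> hu; rewrite -[X in X \in _]addr0 mspec_lin // mspec_zero. Qed.

Lemma mspec_mul a b : a \notin m -> b \notin m -> a * b \notin m.
Proof.
move=> ha hb; apply/negP => hab.
pose J : {pred B} := [pred z | `[< exists2 x, x \in m & exists c, z = x + c * a >]].
have mJ : {subset m <= J}.
  by move=> z hz; apply/asboolP; exists z => //; exists 0; rewrite mul0r addr0.
have J1 : 1 \in J.
  apply/negP => /negP nJ1.
  case: (mspecP m) => _ /(_ J _ mJ) h.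
  move/negP: ha; apply; apply: h; last first.
    by apply/asboolP; exists 0; rewrite ?mspec_zero //; exists 1; rewrite add0r mul1r.
  split => //; first exact/mJ/mspec_zero.
  move=> x _ _ /asboolP[u hu [c ->]] /asboolP[v hv [d ->]].
  apply/asboolP; exists (x * u + v); first exact: mspec_lin.
  by exists (x * c + d); ring.
move/asboolP: J1 => [x hx [c h1]].
move/negP: hb; apply.
have -> : b = b * x + c * (a * b) by rewrite -[LHS]mulr1 h1; ring.
by apply: mspec_lin => //; exact: mspec_mull.
Qed.

Lemma mspec_neq0 s : s \notin m -> s != 0.
Proof. by apply: contraNneq => ->; exact: mspec_zero. Qed.

End MaximalIdeal.

Section Subrings.
Variable B : idomainType.

Definition int_frac : {pred {fraction B}} := [pred q | `[< exists a, q = a%:F >]].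

Lemma int_frac_subring : subring_closed int_frac.
Proof.
split; first by apply/asboolP; exists 1; rewrite rmorph1.
- move=> _ _ /asboolP[a ->] /asboolP[b ->].
  by apply/asboolP; exists (a - b); rewrite rmorphB.
- move=> _ _ /asboolP[a ->] /asboolP[b ->].
  by apply/asboolP; exists (a * b); rewrite rmorphM.
Qed.

HB.instance Definition _ :=
  GRing.isSubringClosed.Build {fraction B} int_frac int_frac_subring.

Variable m : MSpec B.

Definition loc_frac : {pred {fraction B}} :=
  [pred q | `[< exists a s, s \notin m /\ q = a%:F / s%:F >]].

Lemma tofrac_neq0 s : s \notin m -> s%:F != 0.
Proof. by move=> /mspec_neq0; rewrite tofrac_eq0. Qed.

Lemma loc_frac_subring : subring_closed loc_frac.
Proof.
split.
- by apply/asboolP; exists 1, 1; rewrite mspec_one rmorph1 divr1.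
- move=> _ _ /asboolP[a [s [hs ->]]] /asboolP[b [t [ht ->]]].
  apply/asboolP; exists (a * t - b * s), (s * t); split; first exact: mspec_mul.
  by rewrite tofracB !tofracM -mulNr addf_div ?tofrac_neq0 // mulNr.
- move=> _ _ /asboolP[a [s [hs ->]]] /asboolP[b [t [ht ->]]].
  apply/asboolP; exists (a * b), (s * t); split; first exact: mspec_mul.
  by rewrite !tofracM mulf_div.
Qed.

HB.instance Definition _ :=
  GRing.isSubringClosed.Build {fraction B} loc_frac loc_frac_subring.

Lemma int_loc : {subset int_frac <= loc_frac}.
Proof.
move=> _ /asboolP[a ->]; apply/asboolP; exists a, 1.
by rewrite mspec_one rmorph1 divr1.
Qed.

Record loc_ring := MkLoc { loc_val : {fraction B}; locP : loc_val \in loc_frac }.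

HB.instance Definition _ := [isSub for loc_val].
HB.instance Definition _ := [Choice of loc_ring by <:].
HB.instance Definition _ := [SubChoice_isSubComNzRing of loc_ring by <:].

End Subrings.

Arguments int_frac B : clear implicits.

(* For a subring A of a field F with Frac(A) = F, this is Gamma(A): its elements
   are the cosets aU of the unit group U of A in the multiplicative group of F.
   Both Gamma(B) and Gamma(B_M) are instances with F = Q(B) = Q(B_M). *)
Section Divisibility.
Variables (F : fieldType) (A : subringClosed F).

Definition unit_group : set F := [set u | [/\ u != 0, u \in A & u^-1 \in A]].

Definition ucoset (a : F) : set F := [set a * u | u in unit_group].

Record Gamma := MkGamma {
  gset : set F;
  gsetP : exists2 a, a != 0 & gset = ucoset a }.

Lemma gsetI d e : gset d = gset e -> d = e.
Proof. by case: d e => [d p] [e q] /= E; subst; congr MkGamma; exact: Prop_irrelevance. Qed.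

Definition gucoset (a : F) (a0 : a != 0) : Gamma :=
  @MkGamma (ucoset a) (ex_intro2 _ _ a a0 erefl).

Definition gle (d e : Gamma) : Prop :=
  exists a b, [/\ gset d = ucoset a, gset e = ucoset b, a != 0, b != 0 &
    b * a^-1 \in A].

(* f is the infimum d /\ e *)
Definition gmeet (d e f : Gamma) : Prop :=
  [/\ gle f d, gle f e & forall g, gle g d -> gle g e -> gle g f].

Lemma unit_group1 : unit_group 1.
Proof. by split; rewrite ?invr1 ?oner_eq0 ?rpred1. Qed.

Lemma unit_groupM u v : unit_group u -> unit_group v -> unit_group (u * v).
Proof.
move=> [u0 uA uVA] [v0 vA vVA].
by split; rewrite ?mulf_neq0 // ?invfM rpredM.
Qed.

Lemma unit_groupV u : unit_group u -> unit_group u^-1.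
Proof. by move=> [u0 uA uVA]; split; rewrite ?invr_eq0 ?invrK. Qed.

Lemma ucoset_mul a b :
  [set x * y | x in ucoset a & y in ucoset b] = ucoset (a * b).
Proof.
apply/seteqP; split.
  move=> _ [_ [u hu <-] [_ [v hv <-] <-]].
  by exists (u * v); [exact: unit_groupM | ring].
move=> _ [u hu <-]; exists (a * u); first by exists u.
by exists b; [exists 1; [exact: unit_group1 | exact: mulr1] | ring].
Qed.

Lemma gmul_proof (d e : Gamma) : exists2 a, a != 0 &
  [set x * y | x in gset d & y in gset e] = ucoset a.
Proof.
have [a a0 ->] := gsetP d; have [b b0 ->] := gsetP e.
by exists (a * b); [exact: mulf_neq0 | exact: ucoset_mul].
Qed.

Definition gmul (d e : Gamma) : Gamma := MkGamma (gmul_proof d e).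

Definition gpos (d : Gamma) : Prop :=
  exists a, [/\ a \in A, a != 0 & gset d = ucoset a].

Definition GammaPos : Type := {d : Gamma | gpos d}.

Lemma gmul_pos (d e : GammaPos) : gpos (gmul (sval d) (sval e)).
Proof.
case: d e => [d [a [aA a0 da]]] [e [b [bA b0 eb]]].
exists (a * b); split; [exact: rpredM | exact: mulf_neq0 |].
by rewrite /= da eb ucoset_mul.
Qed.

Definition gmulp (d e : GammaPos) : GammaPos := exist _ _ (gmul_pos d e).

Definition gpcoset (a : F) (aA : a \in A) (a0 : a != 0) : GammaPos :=
  exist _ (gucoset a0) (ex_intro _ a (And3 aA a0 erefl)).

Definition gone : GammaPos := gpcoset (rpred1 A) (oner_neq0 F).

End Divisibility.

(* aU |-> aU', the product being taken of the subsets aU and U' of F *)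
Section GammaMap.
Variables (F : fieldType) (A A' : subringClosed F) (AA' : {subset A <= A'}).

Lemma gmap_proof (d : Gamma A) : exists2 a, a != 0 &
  [set x * u | x in gset d & u in unit_group A'] = ucoset A' a.
Proof.
have [a a0 ->] := gsetP d; exists a => //; apply/seteqP; split.
  move=> _ [_ [u [u0 uA uVA] <-] [v hv <-]].
  exists (u * v); last by rewrite mulrA.
  by apply: unit_groupM => //; split=> //; exact: AA'.
move=> _ [u hu <-]; exists a; last by exists u.
by exists 1; [exact: unit_group1 | exact: mulr1].
Qed.

Definition gmap (d : Gamma A) : Gamma A' := MkGamma (gmap_proof d).

End GammaMap.

Section BezoutGamma.
Variable B : idomainType.

Lemma int_fracP (a : B) : a%:F \in int_frac B.
Proof. by apply/asboolP; exists a. Qed.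

Lemma tofrac_nz (a : B) : a != 0 -> a%:F != 0.
Proof. by rewrite tofrac_eq0. Qed.

Definition GammaB := Gamma (int_frac B).
Definition GammaBPos := GammaPos (int_frac B).

Definition vB (a : B) (a0 : a != 0) : GammaBPos :=
  gpcoset (int_fracP a) (tofrac_nz a0).

Definition GammaL (m : MSpec B) := Gamma (loc_frac m).
Definition GammaLPos (m : MSpec B) := GammaPos (loc_frac m).

Lemma loc_val_nz (m : MSpec B) (a : loc_ring m) : a != 0 -> loc_val a != 0.
Proof. by rewrite -val_eqE. Qed.

Definition vL (m : MSpec B) (a : loc_ring m) (a0 : a != 0) : GammaLPos m :=
  gpcoset (locP a) (loc_val_nz a0).

Definition delta_at (m : MSpec B) (d : GammaB) : GammaL m := gmap (@int_loc B m) d.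

End BezoutGamma.

(* M_M is the module of fractions x/s with x in M and s outside the maximal ideal,
   where x/s = y/t iff r(tx - sy) = 0 for some r outside the maximal ideal. *)
Section Localization.
Variables (B : idomainType) (M : lmodType B) (m : MSpec B).

Definition denom : Type := {s : B | s \notin m}.
HB.instance Definition _ := Choice.on denom.
HB.instance Definition _ := [isSub for (@sval B (fun s => s \notin m) : denom -> B)].

Definition predenom : Type := (M * denom)%type.
HB.instance Definition _ := Choice.on predenom.

Definition loc_eqv (x y : predenom) : bool :=
  `[< exists2 r, r \notin m & r *: (val y.2 *: x.1 - val x.2 *: y.1) = 0 >].

Lemma loc_eqv_refl : reflexive loc_eqv.
Proof.
move=> x; apply/asboolP; exists 1; first exact: mspec_one.
by rewrite subrr scaler0.
Qed.

Lemma loc_eqv_sym : symmetric loc_eqv.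
Proof.
suff h x y : loc_eqv x y -> loc_eqv y x by move=> x y; apply/idP/idP; exact: h.
move=> /asboolP[r hr h]; apply/asboolP; exists r => //.
by rewrite -opprB scalerN h oppr0.
Qed.

Lemma loc_eqv_trans : transitive loc_eqv.
Proof.
move=> [y [t ht]] [x [s hs]] [z [w hw]] /asboolP[/= p hp h1] /asboolP[/= q hq h2].
apply/asboolP; exists (p * q * t) => /=; first by rewrite !mspec_mul.
have E1 : (p * t) *: x = (p * s) *: y.
  by apply/eqP; rewrite -subr_eq0 -!scalerA -scalerBr h1.
have E2 : (q * w) *: y = (q * t) *: z.
  by apply/eqP; rewrite -subr_eq0 -!scalerA -scalerBr h2.
rewrite scalerBr !scalerA.
have -> : p * q * t * w = (q * w) * (p * t) by ring.
have -> : p * q * t * s = (p * s) * (q * t) by ring.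
rewrite -(scalerA (q * w)) E1 -(scalerA (p * s)) -E2 !scalerA.
by rewrite [q * w * _]mulrC subrr.
Qed.

Canonical loc_equiv := EquivRel loc_eqv loc_eqv_refl loc_eqv_sym loc_eqv_trans.

Definition loc_mod : Type := {eq_quot loc_equiv}.
HB.instance Definition _ := Choice.on loc_mod.

Definition mkfrac (x : M) (s : B) (hs : s \notin m) : loc_mod :=
  \pi_({eq_quot loc_equiv}) (x, exist _ s hs : denom).

Lemma mkfracP x s (hs : s \notin m) y t (ht : t \notin m) :
  mkfrac x hs = mkfrac y ht <->
  exists2 r, r \notin m & (r * t) *: x = (r * s) *: y.
Proof.
split.
  move/eqquotP => /asboolP[r hr /= h]; exists r => //.
  by apply/eqP; rewrite -subr_eq0 -!scalerA -scalerBr h.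
move=> [r hr h]; apply/eqquotP/asboolP; exists r => //=.
by rewrite scalerBr !scalerA h subrr.
Qed.

Lemma mkfrac_ind (P : loc_mod -> Prop) :
  (forall x s (hs : s \notin m), P (mkfrac x hs)) -> forall z, P z.
Proof. by move=> h; apply: quotW => -[x [s hs]]; exact: h. Qed.

Lemma mkfracE x s (hs : s \notin m) y t (ht : t \notin m) :
  t *: x = s *: y -> mkfrac x hs = mkfrac y ht.
Proof.
move=> h; apply/mkfracP; exists 1; first exact: mspec_one.
by rewrite !mul1r.
Qed.

Definition lnum (z : loc_mod) : M := (repr (z : {eq_quot loc_equiv})).1.
Definition lden (z : loc_mod) : B := val (repr (z : {eq_quot loc_equiv})).2.
Lemma ldenP z : lden z \notin m.
Proof. by rewrite /lden; case: (repr _) => [x [s]]. Qed.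

Lemma mkfracK z : mkfrac (lnum z) (ldenP z) = z.
Proof.
rewrite -[RHS](@reprK _ {eq_quot loc_equiv} z) /mkfrac; congr (\pi _).
rewrite /lnum; move: (ldenP z); rewrite /lden.
by case: (repr _) => [x [s hs]] /= hs'; congr (_, exist _ _ _); exact: bool_irrelevance.
Qed.

Lemma mkfrac_repr x s (hs : s \notin m) : exists2 r, r \notin m &
  (r * lden (mkfrac x hs)) *: x = (r * s) *: lnum (mkfrac x hs).
Proof. by apply/(mkfracP x hs _ (ldenP _)); rewrite mkfracK. Qed.

Definition loc_zero : loc_mod := mkfrac 0 (mspec_one m).

Definition loc_add (z w : loc_mod) : loc_mod :=
  mkfrac (lden w *: lnum z + lden z *: lnum w) (mspec_mul (ldenP z) (ldenP w)).

Definition loc_opp (z : loc_mod) : loc_mod := mkfrac (- lnum z) (ldenP z).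

Lemma loc_addE x s (hs : s \notin m) y t (ht : t \notin m) :
  loc_add (mkfrac x hs) (mkfrac y ht) = mkfrac (t *: x + s *: y) (mspec_mul hs ht).
Proof.
have [p hp] := mkfrac_repr x hs; have [q hq] := mkfrac_repr y ht.
rewrite /loc_add; set z := mkfrac x hs; set w := mkfrac y ht => E2 E1.
apply/mkfracP; exists (p * q); first exact: mspec_mul.
rewrite !scalerDr !scalerA; congr (_ + _).
  have -> : p * q * (s * t) * lden w = (q * t * lden w) * (p * s) by ring.
  by rewrite -scalerA -E1 scalerA; congr (_ *: _); ring.
have -> : p * q * (s * t) * lden z = (p * s * lden z) * (q * t) by ring.
by rewrite -scalerA -E2 scalerA; congr (_ *: _); ring.
Qed.

Lemma loc_oppE x s (hs : s \notin m) : loc_opp (mkfrac x hs) = mkfrac (- x) hs.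
Proof.
have [p hp E] := mkfrac_repr x hs.
by apply/mkfracP; exists p => //; rewrite !scalerN E.
Qed.

Lemma loc_addA : associative loc_add.
Proof.
elim/mkfrac_ind => x s hs; elim/mkfrac_ind => y t ht; elim/mkfrac_ind => z w hw.
rewrite !loc_addE; apply: mkfracE.
by rewrite !scalerDr !scalerA !addrA; congr (_ *: _ + _ *: _ + _ *: _); ring.
Qed.

Lemma loc_addC : commutative loc_add.
Proof.
elim/mkfrac_ind => x s hs; elim/mkfrac_ind => y t ht.
by rewrite !loc_addE; apply: mkfracE; rewrite mulrC addrC.
Qed.

Lemma loc_add0 : left_id loc_zero loc_add.
Proof.
elim/mkfrac_ind => x s hs; rewrite loc_addE; apply: mkfracE.
by rewrite scaler0 add0r scale1r mul1r.
Qed.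

Lemma loc_addN : left_inverse loc_zero loc_opp loc_add.
Proof.
elim/mkfrac_ind => x s hs; rewrite loc_oppE loc_addE; apply: mkfracE.
by rewrite scalerN addNr !scaler0.
Qed.

HB.instance Definition _ :=
  GRing.isZmodule.Build loc_mod loc_addA loc_addC loc_add0 loc_addN.

Lemma mkfracD x s (hs : s \notin m) y t (ht : t \notin m) :
  mkfrac x hs + mkfrac y ht = mkfrac (t *: x + s *: y) (mspec_mul hs ht).
Proof. exact: loc_addE. Qed.

Lemma mkfracN x s (hs : s \notin m) : - mkfrac x hs = mkfrac (- x) hs.
Proof. exact: loc_oppE. Qed.

Lemma loc_ring_frac (q : loc_ring m) :
  exists p : B * B, p.2 \notin m /\ loc_val q = p.1%:F / p.2%:F.
Proof. by case: q => q /= /asboolP[a [s [hs E]]]; exists (a, s). Qed.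

Definition rnum (q : loc_ring m) : B := (sval (cid (loc_ring_frac q))).1.
Definition rden (q : loc_ring m) : B := (sval (cid (loc_ring_frac q))).2.

Lemma rdenP q : rden q \notin m.
Proof. by rewrite /rden; case: cid => p /= []. Qed.

Lemma rfracE q : loc_val q = (rnum q)%:F / (rden q)%:F.
Proof. by rewrite /rden /rnum; case: cid => p /= []. Qed.

Definition loc_scale (q : loc_ring m) (z : loc_mod) : loc_mod :=
  mkfrac (rnum q *: lnum z) (mspec_mul (rdenP q) (ldenP z)).

Lemma loc_scaleE q a s (hs : s \notin m) x t (ht : t \notin m) :
  loc_val q = a%:F / s%:F ->
  loc_scale q (mkfrac x ht) = mkfrac (a *: x) (mspec_mul hs ht).
Proof.
rewrite rfracE => /eqP.
rewrite eqr_div ?(tofrac_neq0 hs) ?(tofrac_neq0 (rdenP _)) //.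
rewrite -!tofracM tofrac_eq => /eqP Eq.
have [p hp E] := mkfrac_repr x ht.
rewrite /loc_scale; set z := mkfrac x ht.
apply/mkfracP; exists p => //; rewrite !scalerA.
have -> : p * (s * t) * rnum q = (rnum q * s) * (p * t) by ring.
by rewrite -scalerA -E scalerA Eq; congr (_ *: _); ring.
Qed.

Lemma loc_scaleA a b z : loc_scale a (loc_scale b z) = loc_scale (a * b) z.
Proof.
elim/mkfrac_ind: z => x t ht.
rewrite (loc_scaleE (rdenP b) x ht (rfracE b)).
rewrite (loc_scaleE (rdenP a) _ _ (rfracE a)).
have E : loc_val (a * b) = (rnum a * rnum b)%:F / (rden a * rden b)%:F.
  by rewrite !tofracM -mulf_div -!rfracE.
rewrite (loc_scaleE (mspec_mul (rdenP a) (rdenP b)) _ _ E); apply: mkfracE.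
by rewrite !scalerA; congr (_ *: _); ring.
Qed.

Lemma loc_scale1 : left_id 1 loc_scale.
Proof.
elim/mkfrac_ind => x t ht.
have E : loc_val (1 : loc_ring m) = 1%:F / 1%:F by rewrite rmorph1 divr1.
rewrite (loc_scaleE (mspec_one m) x ht E); apply: mkfracE.
by rewrite mul1r scale1r.
Qed.

Lemma loc_scaleDr : right_distributive loc_scale +%R.
Proof.
move=> q; elim/mkfrac_ind => x s hs; elim/mkfrac_ind => y t ht.
rewrite mkfracD !(loc_scaleE (rdenP q) _ _ (rfracE q)) mkfracD; apply: mkfracE.
by rewrite !scalerDr !scalerA; congr (_ *: _ + _ *: _); ring.
Qed.

Lemma loc_scaleDl z : {morph loc_scale^~ z : a b / a + b}.
Proof.
move=> a b; elim/mkfrac_ind: z => x t ht.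
have E : loc_val (a + b) =
    (rnum a * rden b + rnum b * rden a)%:F / (rden a * rden b)%:F.
  rewrite tofracD !tofracM -addf_div ?(tofrac_neq0 (rdenP _)) //.
  by rewrite -!rfracE.
rewrite (loc_scaleE (mspec_mul (rdenP a) (rdenP b)) x ht E).
rewrite (loc_scaleE (rdenP a) x ht (rfracE a)).
rewrite (loc_scaleE (rdenP b) x ht (rfracE b)) mkfracD; apply: mkfracE.
rewrite !scalerA -scalerDl scalerA; congr (_ *: _); ring.
Qed.

HB.instance Definition _ := GRing.Zmodule_isLmodule.Build (loc_ring m) loc_mod
  loc_scaleA loc_scale1 loc_scaleDr loc_scaleDl.

Definition to_loc (x : M) : loc_mod := mkfrac x (mspec_one m).

End Localization.

(* R is the type of scalars, P the set of indices of the predicates V_delta,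
   X the type of variables *)
Inductive term (R X : Type) : Type :=
| TVar of X
| TZero
| TAdd of term R X & term R X
| TOpp of term R X
| TScale of R & term R X.

Inductive atomic (R P X : Type) : Type :=
| AEq of term R X & term R X
| AV of P & term R X.

Fixpoint map_term (R R' X : Type) (f : R -> R') (t : term R X) : term R' X :=
  match t with
  | TVar x => TVar _ x
  | TZero => TZero _ _
  | TAdd t1 t2 => TAdd (map_term f t1) (map_term f t2)
  | TOpp t1 => TOpp (map_term f t1)
  | TScale r t1 => TScale (f r) (map_term f t1)
  end.

Definition map_atomic (R P R' P' X : Type) (f : R -> R') (g : P -> P')
    (a : atomic R P X) : atomic R' P' X :=
  match a with
  | AEq t1 t2 => AEq _ (map_term f t1) (map_term f t2)
  | AV d t => AV (g d) (map_term f t)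
  end.

Definition conjunction (R P X : Type) : Type := seq (atomic R P X).

Record pp_formula (R P : Type) (n : nat) : Type := PP {
  pp_bound : nat;
  pp_matrix : conjunction R P ('I_n + 'I_pp_bound) }.

Section Satisfaction.
Variables (R : pzRingType) (N : lmodType R) (P : Type) (W : P -> set N).

Fixpoint eval (X : Type) (e : X -> N) (t : term R X) : N :=
  match t with
  | TVar x => e x
  | TZero => 0
  | TAdd t1 t2 => eval e t1 + eval e t2
  | TOpp t1 => - eval e t1
  | TScale r t1 => r *: eval e t1
  end.

Definition sat_atomic (X : Type) (e : X -> N) (a : atomic R P X) : Prop :=
  match a with
  | AEq t1 t2 => eval e t1 = eval e t2
  | AV d t => W d (eval e t)
  end.

Fixpoint sat_conj (X : Type) (e : X -> N) (s : conjunction R P X) : Prop :=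
  if s is a :: s' then sat_atomic e a /\ sat_conj e s' else True.

Definition sat_pp (n : nat) (phi : pp_formula R P n) (u : 'I_n -> N) : Prop :=
  exists x : 'I_(pp_bound phi) -> N,
    sat_conj (fun z => match z with inl i => u i | inr j => x j end)
             (pp_matrix phi).

End Satisfaction.

Record T_V_div (B : idomainType) (M : lmodType B) (V : GammaBPos B -> set M) :
    Prop := {
  TV_zero : forall d, V d 0;
  TV_add : forall d1 d2 d : GammaBPos B, gmeet (sval d1) (sval d2) (sval d) ->
    forall x y, V d1 x -> V d2 y -> V d (x + y);
  TV_meet : forall d e f : GammaBPos B, gmeet (sval d) (sval e) (sval f) ->
    forall x, V d x -> V f x;
  TV_scale : forall (d : GammaBPos B) (a : B) (a0 : a != 0) x,
    V d x -> V (gmulp d (vB a0)) (a *: x);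
  TV_one : forall x, V (gone (int_frac B)) x;
  TV_div : forall (a : B) (a0 : a != 0) x, V (vB a0) x -> exists y, a *: y = x }.

Definition V_loc (B : idomainType) (M : lmodType B) (m : MSpec B)
    (d : GammaLPos m) : set (loc_mod M m) :=
  [set x | exists a (a0 : a != 0) y, d = vL a0 /\ x = a *: y].

Section OverSet.
Variables (B : idomainType) (C : set (MSpec B)).

Definition scalar_over : Type :=
  {q : {fraction B} | forall m, C m -> q \in loc_frac m}.

Definition index_over : Type :=
  {d : GammaB B | forall m, C m -> gpos (delta_at m d)}.

Definition conj_over (n : nat) : Type := conjunction scalar_over index_over 'I_n.

Variables (m : MSpec B) (hm : C m).

Definition scalar_at (q : scalar_over) : loc_ring m := MkLoc (svalP q m hm).

Definition index_at (d : index_over) : GammaLPos m :=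
  exist _ (delta_at m (sval d)) (svalP d m hm).

Definition conj_at (n : nat) (psi : conj_over n) :
    conjunction (loc_ring m) (GammaLPos m) 'I_n :=
  map (map_atomic scalar_at index_at) psi.

End OverSet.

(* Main.v *)
Require Import Defs.
From mathcomp Require Import all_boot all_algebra.
From mathcomp Require Import boolp classical_sets.
From mathcomp Require Import ring.

(* Since [V_{v(a)} M = M a], a pp formula says that a finite linear system over
   [B], with right-hand side linear in the parameters, is solvable in [M].
   Solvability is local: the multipliers of the right-hand side that make the
   system solvable form an ideal of [B].  Over the valuation domain [B_m] the
   system is solved by Gaussian elimination, pivoting on an entry [a] of minimal
   valuation; the pivot row leaves the single condition [V_{v(a)}] on a linear
   form in the parameters, and the other rows lose an unknown.  An entry is a
   possible pivot on the set of those [m] for which finitely many given fractions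
   lie in [B_m].  By Bezout a fraction can be written [a/b] with [(a, b) = 1],
   and it lies in [B_m] iff [b] is not in [m], so that set is constructible. *)

Set Implicit Arguments.
Unset Strict Implicit.
Unset Printing Implicit Defensive.

Import GRing.Theory.

Local Open Scope classical_set_scope.
Local Open Scope ring_scope.

(** * Fractions in lowest terms over a Bézout domain *)

Lemma fraction_eq (B : idomainType) (q : {fraction B}) :
  exists a b : B, b != 0 /\ q = a%:F / b%:F.
Proof.
elim/quotW: q => r; exists (frac r).1, (frac r).2.
have d0 := denom_ratioP r; split=> //.
apply: (canRL (mulfK _)); first by rewrite tofrac_eq0.
unlock FracField.tofrac; rewrite -[LHS]FracField.pi_mul /FracField.mulf.
apply/eqmodP; rewrite /= FracField.equivfE.
by rewrite !numden_Ratio ?mulf_neq0 ?oner_eq0 //= !mulr1 mulrC.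
Qed.

(** Dividing both terms by the generator [d] of the ideal they span leaves coprime ones: [d] is
    nonzero and cancels from the Bézout identity. *)
Lemma frac_coprime (B : idomainType) (hB : bezout_domain B) (q : {fraction B}) :
  exists a b x y : B, [/\ b != 0, q = a%:F / b%:F & x * a + y * b = 1].
Proof.
have [a [b [b0 ->]]] := fraction_eq q.
have [d Ed] := hB [:: a; b].
have gen z : fg_ideal [:: a; b] z <-> exists x y, z = x * a + y * b.
  split.
    move=> [c ->]; exists (c ord0), (c (lift ord0 ord0)).
    by rewrite !big_ord_recl big_ord0 addr0.
  move=> [x [y ->]]; exists (fun i => if val i == 0%N then x else y).
  by rewrite !big_ord_recl big_ord0 addr0.
have [a' Ea] : principal_ideal d a.
  by rewrite -Ed; apply/gen; exists 1, 0; ring.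
have [b' Eb] : principal_ideal d b.
  by rewrite -Ed; apply/gen; exists 0, 1; ring.
have [x [y Exy]] : exists x y, d = x * a + y * b.
  by apply/gen; rewrite Ed; exists 1; rewrite mul1r.
have /norP[b'0 d0] : ~~ ((b' == 0) || (d == 0)) by rewrite -mulf_eq0 -Eb.
exists a', b', x, y; split=> //.
  by rewrite Ea Eb !tofracM -mulf_div divff ?mulr1 // tofrac_eq0.
by apply: (mulIf d0); rewrite mul1r [RHS]Exy Ea Eb; ring.
Qed.

(** * Local rings at maximal ideals as valuation rings *)

Section LocalFractions.
Variables (B : idomainType) (m : MSpec B).

Lemma mspec_coprime (a b x y : B) : x * a + y * b = 1 -> b \in m -> a \notin m.
Proof.
move=> E bm; apply/negP => am; have /negP := mspec_one m; apply.
by rewrite -E mspec_lin // mspec_mull.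
Qed.

Lemma loc_frac_div (a s : B) : s \notin m -> a%:F / s%:F \in loc_frac m.
Proof. by move=> sm; apply/asboolP; exists a, s. Qed.

Lemma loc_frac_coprimeE (a b x y : B) : b != 0 -> x * a + y * b = 1 ->
  (a%:F / b%:F \in loc_frac m) = (b \notin m).
Proof.
move=> b0 E; apply/idP/idP; last exact: loc_frac_div.
move=> /asboolP[c [s [sm /eqP]]].
rewrite eqr_div ?tofrac_eq0 ?(mspec_neq0 sm) // -!tofracM tofrac_eq => /eqP Eas.
apply/negP => bm; have /negP := mspec_mul (mspec_coprime E bm) sm; apply.
by rewrite Eas mspec_mull.
Qed.

Lemma tofrac_loc (a : B) : a%:F \in loc_frac m.
Proof. exact/int_loc/int_fracP. Qed.

Hypothesis hB : bezout_domain B.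

(** In lowest terms, numerator and denominator cannot both lie in [m], so one of them may serve as
    denominator. *)
Lemma loc_frac_valuation (q : {fraction B}) :
  q \in loc_frac m \/ q^-1 \in loc_frac m.
Proof.
have [a [b [x [y [b0 -> E]]]]] := frac_coprime hB q.
have [bm|bm] := boolP (b \in m); last by left; exact: loc_frac_div.
by right; rewrite invf_div; apply: loc_frac_div; exact: mspec_coprime E bm.
Qed.

Lemma exists_min_valuation (s : seq {fraction B}) : has (fun q => q != 0) s ->
  exists q, [/\ q \in s, q != 0 & forall r, r \in s -> r / q \in loc_frac m].
Proof.
elim: s => //= p s IH.
have [/IH[q [qs q0 qdiv]] _|/hasPn s0] := boolP (has _ s); last first.
  rewrite orbF => p0; exists p; rewrite mem_head; split=> // r.
  rewrite inE => /predU1P[->|/s0]; first by rewrite divff ?rpred1.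
  by rewrite negbK => /eqP ->; rewrite mul0r rpred0.
have [pq|] := loc_frac_valuation (p / q).
  exists q; rewrite inE qs orbT; split=> // r.
  by rewrite inE => /predU1P[->|/qdiv].
rewrite invf_div => qp.
(* For [p = 0] the quotient [q / p] is [0] by convention, so [qp] says nothing and [q] remains the
   minimum. *)
have [p0|p0] := eqVneq p 0.
  exists q; rewrite inE qs orbT; split=> // r.
  by rewrite inE => /predU1P[->|/qdiv //]; rewrite p0 mul0r rpred0.
exists p; rewrite mem_head; split=> // r.
rewrite inE => /predU1P[->|/qdiv rq]; first by rewrite divff ?rpred1.
have -> : r / p = r / q * (q / p) by rewrite mulrA divfK.
exact: rpredM.
Qed.

End LocalFractions.

(** * Constructible sets of maximal ideals *)

Section Constructible.
Variable B : idomainType.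

Lemma constructibleT : constructible [set: MSpec B].
Proof.
have -> : [set: MSpec B] = Vset 0; last exact: constructible_V.
by apply/seteqP; split=> // m _; exact: mspec_zero.
Qed.

Lemma constructible0 : @constructible B set0.
Proof. by rewrite -setCT; apply: constructible_C; exact: constructibleT. Qed.

Lemma constructible_all (T : eqType) (s : seq T) (D : T -> set (MSpec B)) :
  (forall t, constructible (D t)) ->
  constructible [set m | forall t, t \in s -> D t m].
Proof.
move=> hD; elim: s => [|t s IH].
  suff -> : [set m | forall t, t \in [::] -> D t m] = setT.
    exact: constructibleT.
  by apply/seteqP; split.
suff -> : [set m | forall t', t' \in t :: s -> D t' m] =
    D t `&` [set m | forall t', t' \in s -> D t' m].
  exact: constructible_I.
apply/seteqP; split=> m /=.
  move=> h; split; first by apply: h; rewrite mem_head.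
  by move=> t' t's; apply: h; rewrite inE t's orbT.
by move=> [h1 h2] t'; rewrite inE => /predU1P[->|/h2].
Qed.

Lemma constructible_loc_frac (q : {fraction B}) : bezout_domain B ->
  constructible [set m | q \in loc_frac m].
Proof.
move=> hB; have [a [b [x [y [b0 -> E]]]]] := frac_coprime hB q.
suff -> : [set m | a%:F / b%:F \in loc_frac m] = ~` Vset b.
  by apply: constructible_C; exact: constructible_V.
by apply/seteqP; split=> m /=; rewrite (loc_frac_coprimeE m b0 E) => /negP.
Qed.

End Constructible.

(** Krull's theorem. Zorn is applied to the sets [X] whose union with [J] is a proper ideal, so that
    the empty chain is admissible too: its union gives back [J]. *)
Lemma maximal_ideal_exists (B : idomainType) (J : set B) :
  J 0 -> ~ J 1 -> (forall a u v, J u -> J v -> J (a * u + v)) ->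
  exists m : MSpec B, forall x, J x -> x \in m.
Proof.
move=> J0 J1 Jlin.
pose pr (X : set B) := [/\ X 0, ~ X 1 & forall a u v, X u -> X v -> X (a * u + v)].
have prJ : pr J by [].
have [F hF tot|A [prA Amax]] := @Zorn_bigcup B [set X | pr (J `|` X)].
  have [[X0 FX0]|F0] := pselect (exists X, F X); last first.
    rewrite /= /pr; suff -> : J `|` \bigcup_(X in F) X = J by [].
    by apply/seteqP; split=> [x [//|[X FX _]]|x]; [case: F0; exists X|left].
  rewrite /= /pr; split; first by left.
    move=> [//|[X FX X1]]; have [_ h _] := hF _ FX; apply: h; by right.
  have sub X a u v : F X -> (J `|` X) u -> (J `|` X) v ->
      (J `|` \bigcup_(X in F) X) (a * u + v).
    move=> FX hu hv; have [_ _ h] := hF _ FX.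
    by case: (h a _ _ hu hv) => ?; [left | right; exists X].
  move=> a u v [Ju|[X FX Xu]] [Jv|[Y FY Yv]].
  - by apply: (sub X0) => //; left.
  - by apply: (sub Y) => //; [left | right].
  - by apply: (sub X) => //; [right | left].
  - have [XY|YX] := tot _ _ FX FY.
      by apply: (sub Y) => //; right => //; exact: XY.
    by apply: (sub X) => //; right => //; exact: YX.
have [A0 A1 Alin] : pr (J `|` A) := prA.
pose I : B -> bool := fun x => `[< (J `|` A) x >].
have mI : maximal_ideal I.
  split.
    split; [exact/asboolP | exact/asboolP |].
    by move=> a u v /asboolP hu /asboolP hv; apply/asboolP/Alin.
  move=> K [K0 K1 Klin] IK x xK; apply: contrapT => xI.
  have AI y : (J `|` A) y -> y \in K by move=> hy; apply: IK; exact/asboolP.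
  apply: (Amax [set y | y \in K]); last first.
    have -> : [set X | pr (J `|` X)] [set y | y \in K] = pr [set y | y \in K].
      rewrite /=; congr pr; apply/seteqP; split=> y /=; last by right.
      by move=> [Jy|//]; apply: AI; left.
    by split=> //; exact/negP.
  rewrite properEneq; split; last by move=> y Ay; apply: AI; right.
  by apply/eqP => AK; apply: xI; apply/asboolP; right; rewrite AK.
by exists (MkMSpec mI) => x Jx; apply/asboolP; left.
Qed.

(** * Linear systems and the elimination of one unknown *)

Section LinearForms.
Variables (A : comNzRingType) (N : lmodType A).

Definition linform (I : finType) (f : I -> A) (e : I -> N) : N :=
  \sum_i f i *: e i.

Definition join (T Y X : Type) (u : Y -> T) (x : X -> T) (z : Y + X) : T :=
  match z with inl i => u i | inr j => x j end.

Lemma linform_join (Y X : finType) (f : Y + X -> A) (u : Y -> N) (x : X -> N) :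
  linform f (join u x) = linform (f \o inl) u + linform (f \o inr) x.
Proof. by rewrite /linform big_sumType. Qed.

Lemma linformB (I : finType) (f g : I -> A) c (e : I -> N) :
  linform (fun i => f i - c * g i) e = linform f e - c *: linform g e.
Proof.
rewrite /linform scaler_sumr -sumrB; apply: eq_bigr => i _.
by rewrite scalerBl scalerA.
Qed.

Lemma linformZ (I : finType) (f : I -> A) c (e : I -> N) :
  linform (fun i => c * f i) e = c *: linform f e.
Proof.
by rewrite /linform scaler_sumr; apply: eq_bigr => i _; rewrite scalerA.
Qed.

Lemma linform_lin (I : finType) (f : I -> A) a (e e' : I -> N) :
  linform f (fun i => a *: e i + e' i) = a *: linform f e + linform f e'.
Proof.
rewrite /linform scaler_sumr -big_split; apply: eq_bigr => i _ /=.
by rewrite scalerDr !scalerA mulrC.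
Qed.

Lemma linform_update (X : finType) (f : X -> A) (x : X -> N) j z :
  linform f (fun k => if k == j then x j - z else x k) =
  linform f x - f j *: z.
Proof.
rewrite /linform (bigD1 j) //= [in RHS](bigD1 j) //= eqxx scalerBr addrAC.
by congr (_ + _ - _); apply: eq_bigr => k /negPf ->.
Qed.

(** Parameters ([Y]) and unknowns ([X]) share one row of coefficients, so that row operations act on
    both at once. *)
Definition solvable_system (T : eqType) (Y X : finType) (s : seq T)
    (f : T -> Y + X -> A) (u : Y -> N) : Prop :=
  exists x : X -> N, forall t, t \in s -> linform (f t) (join u x) = 0.

(* The pivot [f t0 (inr j)] divides its row and its column: the substitution
   [x j := linform d x] turns row [t0] into a divisibility condition on [u],
   and the unknown [x j] disappears from the other rows. *)
Lemma solvable_system_pivot (T : eqType) (Y X : finType) (s : seq T)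
    (f : T -> Y + X -> A) (u : Y -> N) (t0 : T) (j : X) (c : T -> A) (d : X -> A) :
  t0 \in s -> (forall t, t \in s -> f t (inr j) = c t * f t0 (inr j)) ->
  (forall k, f t0 (inr k) = f t0 (inr j) * d k) -> d j = 1 ->
  solvable_system s f u <->
  (exists y, linform (f t0 \o inl) u = f t0 (inr j) *: y) /\
  solvable_system (rem t0 s) (fun t i => f t i - c t * f t0 i) u.
Proof.
move=> t0s fc fd dj; set a := f t0 (inr j).
have row0 x : linform (f t0) (join u x) =
    linform (f t0 \o inl) u + a *: linform d x.
  rewrite linform_join -linformZ; congr (_ + _).
  by apply: eq_bigr => k _; rewrite /= fd.
split.
  move=> [x hx]; split.
    exists (- linform d x); apply/eqP.
    by rewrite scalerN -addr_eq0 -row0 hx.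
  by exists x => t /mem_rem ts; rewrite linformB !hx // scaler0 subr0.
move=> [[y hy] [x hx]].
(* Since [d j = 1], this shift of the unknown [j] makes [linform d x'] equal to [- y], which solves
   the row [t0]. *)
pose x' k := if k == j then x j - (y + linform d x) else x k.
have row0' : linform (f t0) (join u x') = 0.
  rewrite row0 hy linform_update dj scale1r opprD addrCA subrr addr0.
  by rewrite scalerN subrr.
exists x' => t; rewrite (perm_mem (perm_to_rem t0s)) inE.
case/predU1P => [->//|ts].
have := hx t ts; rewrite linform_join.
have <- : linform ((fun i => f t i - c t * f t0 i) \o inr) x' =
    linform ((fun i => f t i - c t * f t0 i) \o inr) x.
  by rewrite linform_update /= (fc t (mem_rem ts)) subrr scale0r subr0.
by rewrite -linform_join linformB row0' scaler0 subr0.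
Qed.

End LinearForms.

(** * Linear systems over the localizations *)

Section LocalSystems.
Variables (B : idomainType) (M : lmodType B).

(* Junk value [0] for fractions outside the local ring. *)
Definition loc_of (m : MSpec B) (q : {fraction B}) : loc_ring m := insubd 0 q.

Lemma loc_ofK m q : q \in loc_frac m -> loc_val (loc_of m q) = q.
Proof. exact: insubdK. Qed.

Lemma loc_val_inj m : injective (@loc_val B m).
Proof. exact: val_inj. Qed.

Lemma loc_valM (m : MSpec B) (a b : loc_ring m) :
  loc_val (a * b) = loc_val a * loc_val b.
Proof. by []. Qed.

Lemma loc_valB (m : MSpec B) (a b : loc_ring m) :
  loc_val (a - b) = loc_val a - loc_val b.
Proof. by []. Qed.

Lemma scalar_atE (C : set (MSpec B)) m (hm : C m) (q : scalar_over C) :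
  scalar_at hm q = loc_of m (sval q).
Proof. by apply: loc_val_inj; rewrite loc_ofK //; exact: (svalP q). Qed.

Lemma loc_ofM m q r : q \in loc_frac m -> r \in loc_frac m ->
  loc_of m (q * r) = loc_of m q * loc_of m r.
Proof.
move=> hq hr; apply: loc_val_inj; rewrite loc_valM !loc_ofK //; exact: rpredM.
Qed.

Lemma loc_ofB m q r : q \in loc_frac m -> r \in loc_frac m ->
  loc_of m (q - r) = loc_of m q - loc_of m r.
Proof.
move=> hq hr; apply: loc_val_inj; rewrite loc_valB !loc_ofK //; exact: rpredB.
Qed.

Lemma loc_of1 m : loc_of m 1 = 1.
Proof. by apply: loc_val_inj; rewrite loc_ofK ?rpred1. Qed.

Lemma loc_of0 m : loc_of m 0 = 0.
Proof. by apply: loc_val_inj; rewrite loc_ofK ?rpred0. Qed.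

Section Atoms.
Variable C : set (MSpec B).

(** The scalars are fractions that lie in the local ring of every [m] in [C], so a single term can
    be read at all these points. *)
Lemma linform_term n (g : 'I_n -> {fraction B}) :
  (forall m, C m -> forall i, g i \in loc_frac m) ->
  exists t : term (scalar_over C) 'I_n,
    forall m (hm : C m) (u : 'I_n -> loc_mod M m),
      eval u (map_term (scalar_at hm) t) = linform (loc_of m \o g) u.
Proof.
move=> hg; rewrite /linform.
elim: (index_enum 'I_n) => [|i s [t ht]].
  by exists (TZero _ _) => m hm u; rewrite big_nil.
have gi m : C m -> g i \in loc_frac m by move=> /hg.
exists (TAdd (TScale (exist _ (g i) gi) (TVar _ i)) t) => m hm u.
by rewrite big_cons -(ht m hm) /= scalar_atE.
Qed.

Lemma gset_delta_at m (a : {fraction B}) (a0 : a != 0) :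
  gset (delta_at m (gucoset (int_frac B) a0)) = ucoset (loc_frac m) a.
Proof.
apply/seteqP; split.
  move=> _ [_ [u [u0 uA uVA] <-] [v hv <-]].
  exists (u * v); last by rewrite mulrA.
  by apply: unit_groupM => //; split=> //; exact: int_loc.
move=> _ [u hu <-]; exists a; last by exists u.
by exists 1; [exact: unit_group1 | exact: mulr1].
Qed.

(** The class of [a] fixes its representatives only up to units of the local ring, and a unit [v] is
    absorbed by the witness, [y] becoming [v *: y]. *)
Lemma divisibility_index (a : {fraction B}) : a != 0 ->
  (forall m, C m -> a \in loc_frac m) ->
  exists d : index_over C, forall m (hm : C m) (x : loc_mod M m),
    V_loc (index_at hm d) x <-> exists y, x = loc_of m a *: y.
Proof.
move=> a0 ha.
have hpos m : C m -> gpos (delta_at m (gucoset (int_frac B) a0)).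
  by move=> hm; exists a; split=> //; [exact: ha | exact: gset_delta_at].
exists (exist _ _ hpos) => m hm x; split.
  move=> [b [b0 [y [/(congr1 sval) /= E ->]]]].
  have : ucoset (loc_frac m) (loc_val b) = ucoset (loc_frac m) a.
    by rewrite -(gset_delta_at m a0) E.
  move=> /seteqP[+ _] => /(_ (loc_val b)).
  case; first by exists 1; [exact: unit_group1 | exact: mulr1].
  move=> v [_ vm _] Ev; exists (loc_of m v *: y); rewrite scalerA -loc_ofM ?ha //.
  by congr (_ *: _); apply: loc_val_inj; rewrite Ev loc_ofK //; exact: locP.
move=> [y ->]; have b0 : loc_of m a != 0.
  by rewrite -val_eqE /= loc_ofK ?ha.
exists (loc_of m a), b0, y; split=> //; apply: eq_exist; apply: gsetI.
by rewrite gset_delta_at /= loc_ofK ?ha.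
Qed.

Lemma equations_conj n (T : eqType) (s : seq T) (g : T -> 'I_n -> {fraction B}) :
  (forall m, C m -> forall t, t \in s -> forall i, g t i \in loc_frac m) ->
  exists psi : conj_over C n, forall m (hm : C m) (u : 'I_n -> loc_mod M m),
    (forall t, t \in s -> linform (loc_of m \o g t) u = 0) <->
    sat_conj (@V_loc B M m) u (conj_at hm psi).
Proof.
elim: s => [|t s IH] hs; first by exists [::].
have [|psi hpsi] := IH.
  by move=> m hm t' t's; apply: hs => //; rewrite inE t's orbT.
have [|e he] := @linform_term n (g t).
  by move=> m hm; apply: hs => //; exact: mem_head.
exists (AEq _ e (TZero _ _) :: psi) => m hm u /=; rewrite he; split.
  move=> h; split; first exact/h/mem_head.
  by apply/hpsi => t' t's; apply: h; rewrite inE t's orbT.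
by move=> [h1 /hpsi h2] t'; rewrite inE => /predU1P[->|/h2].
Qed.

End Atoms.

(** * Gaussian elimination on constructible pieces *)

Section Resolution.
Variables (hB : bezout_domain B) (n : nat) (X : finType).
Let row := {ffun 'I_n + X -> {fraction B}}.

Definition loc_solvable (m : MSpec B) (s : seq row) (u : 'I_n -> loc_mod M m) :=
  solvable_system s (fun r => loc_of m \o r) u.

(** The pieces lie inside [C], so that they inherit what holds on [C] and the resolutions over a
    cover can be glued. *)
Definition resolvable (C : set (MSpec B)) (s : seq row) : Prop :=
  exists (K : finType) (D : K -> set (MSpec B)) (psi : forall k, conj_over (D k) n),
    [/\ forall k, constructible (D k) /\ D k `<=` C,
        forall m, C m -> exists k, D k m &
        forall k m (hm : D k m) u,
          loc_solvable s u <-> sat_conj (@V_loc B M m) u (conj_at hm (psi k))].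

Lemma resolvable_set0 s : resolvable set0 s.
Proof.
exists 'I_0, (fun=> set0), (fun=> [::]); split=> // [k].
by split=> //; exact: constructible0.
Qed.

Lemma resolvable_cover (I : finType) (C : set (MSpec B)) (D : I -> set (MSpec B)) s :
  (forall i, D i `<=` C) -> (forall m, C m -> exists i, D i m) ->
  (forall i, resolvable (D i) s) -> resolvable C s.
Proof.
(* The pieces depend on the index set and the conjunctions on the pieces, so the three choices are
   made one after the other. *)
move=> DC CD h0; have h1 i := cid (h0 i).
pose K i := sval (h1 i); have h2 i := cid (svalP (h1 i) : exists E, _).
pose E i : K i -> set (MSpec B) := sval (h2 i); have h3 i := cid (svalP (h2 i)).
pose psi i : forall k, conj_over (E i k) n := sval (h3 i).
have h i := svalP (h3 i).
exists {i : I & K i}, (fun k => E (tag k) (tagged k)),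
  (fun k => psi (tag k) (tagged k)); split.
- move=> [i k]; have [hc _ _] := h i; have [kc kD] := hc k.
  by split=> // m /kD; exact: DC.
- move=> m /CD[i Dim]; have [_ hD _] := h i.
  by have [k km] := hD m Dim; exists (Tagged K k).
- by move=> [i k] m hm u /=; have [_ _ hs] := h i; exact: hs.
Qed.

(** Base case of the elimination: once the unknowns have zero coefficients, only equations in the
    parameters remain, and the unknowns may be set to [0]. *)
Lemma resolvable_equations C (s : seq row) : constructible C ->
  (forall m, C m -> forall r, r \in s -> forall i, r i \in loc_frac m) ->
  (forall r, r \in s -> forall j, r (inr j) = 0) -> resolvable C s.
Proof.
move=> hC hs s0.
have [|psi hpsi] := @equations_conj C n _ s (fun r i => r (inl i)).
  by move=> m hm r rs i; exact: hs.
exists unit, (fun=> C), (fun=> psi); split=> [_|m Cm|_ m hm u]; [by split | by exists tt |].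
have rowE r x : r \in s ->
    linform (loc_of m \o r) (join u x) = linform (loc_of m \o (r \o inl)) u.
  move=> rs; rewrite linform_join [X in _ + X]big1 ?addr0 // => j _.
  by rewrite /= s0 // loc_of0 scale0r.
rewrite -hpsi; split=> [[x hx] r rs|h].
  by have := hx r rs; rewrite rowE.
by exists (fun=> 0) => r rs; rewrite rowE //; exact: h.
Qed.

Definition eliminate (r0 : row) (j : X) (r : row) : row :=
  [ffun i => r i - r (inr j) / r0 (inr j) * r0 i].

(** Only coefficients of unknowns are compared with the pivot. A zero entry is excluded by hand:
    quotients by [0] are [0] and would pass the test. *)
Definition pivot_set (C : set (MSpec B)) (s : seq row) (r0 : row) (j : X) :
    set (MSpec B) :=
  if r0 (inr j) == 0 then set0 else
  C `&` [set m | forall rk, rk \in [seq (r, k) | r <- s, k <- enum X] ->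
                 rk.1 (inr rk.2) / r0 (inr j) \in loc_frac m].

Lemma pivot_setP C s r0 j m : pivot_set C s r0 j m <->
  [/\ r0 (inr j) != 0, C m &
      forall r k, r \in s -> r (inr k) / r0 (inr j) \in loc_frac m].
Proof.
rewrite /pivot_set; case: eqP => _; first by split => // -[].
split.
  move=> [Cm h]; split=> // r k rs; apply: (h (r, k)).
  by apply/allpairsP; exists (r, k); rewrite mem_enum.
move=> [_ Cm h]; split=> // -[r k] /allpairsP[[r' k'] /= [rs _ [-> ->]]].
exact: h.
Qed.

Lemma constructible_pivot_set C s r0 j :
  constructible C -> constructible (pivot_set C s r0 j).
Proof.
move=> hC; rewrite /pivot_set; case: eqP => _; first exact: constructible0.
apply: constructible_I => //; apply: (@constructible_all _ _ _ (fun rk : row * X =>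
  [set m | rk.1 (inr rk.2) / r0 (inr j) \in loc_frac m])) => rk.
exact: constructible_loc_frac.
Qed.

(** On the pivot set the quotients by the pivot are integral at [m], so the row operations over the
    fraction field descend to the local ring and [solvable_system_pivot] applies. *)
Lemma loc_solvable_pivot C (s : seq row) r0 j m (u : 'I_n -> loc_mod M m) :
  (forall r, r \in s -> forall i, r i \in loc_frac m) ->
  r0 \in s -> pivot_set C s r0 j m ->
  loc_solvable s u <->
  (exists y, linform (loc_of m \o (r0 \o inl)) u = loc_of m (r0 (inr j)) *: y) /\
  loc_solvable [seq eliminate r0 j r | r <- rem r0 s] u.
Proof.
move=> hs r0s /pivot_setP[a0 _ hdiv].
rewrite /loc_solvable.
rewrite (solvable_system_pivot u (t0 := r0) (j := j)
  (c := fun r => loc_of m (r (inr j) / r0 (inr j)))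
  (d := fun k => loc_of m (r0 (inr k) / r0 (inr j)))) //; first last.
- by rewrite divff // loc_of1.
- by move=> k /=; rewrite -loc_ofM ?hdiv ?hs // mulrC divfK.
- by move=> r rs /=; rewrite -loc_ofM ?hdiv ?hs // divfK.
have elimE r x : r \in rem r0 s ->
    linform (loc_of m \o eliminate r0 j r) (join u x) =
    linform (fun i => (loc_of m \o r) i -
      loc_of m (r (inr j) / r0 (inr j)) * (loc_of m \o r0) i) (join u x).
  move=> /mem_rem rs; apply: eq_bigr => i _; rewrite /= ffunE.
  have hc := hdiv r j rs; have h0 := hs r0 r0s i.
  by rewrite (loc_ofB (hs r rs i) (rpredM hc h0)) (loc_ofM hc h0).
split=> -[hy [x hx]]; split=> //; exists x.
  by move=> _ /mapP[r rs ->]; rewrite elimE //; exact: hx.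
by move=> r rs; rewrite -elimE //; apply: hx; exact: map_f.
Qed.

(** The pieces for the reduced system are kept; each conjunction gains one atom, the divisibility by
    the pivot of the parameter part of its row. *)
Lemma resolvable_pivot C (s : seq row) r0 j : r0 \in s ->
  (forall m, C m -> forall r, r \in s -> forall i, r i \in loc_frac m) ->
  resolvable (pivot_set C s r0 j) [seq eliminate r0 j r | r <- rem r0 s] ->
  resolvable (pivot_set C s r0 j) s.
Proof.
move=> r0s hs; have [a0|a0] := eqVneq (r0 (inr j)) 0.
  by rewrite /pivot_set a0 eqxx => _; exact: resolvable_set0.
move=> [K [D [psi [hD cov hpsi]]]].
have DC k m : D k m -> C m by case: (hD k) => _ /[apply] /pivot_setP[].
have [e he] : exists e : forall k, term (scalar_over (D k)) 'I_n,
    forall k m (hm : D k m) (u : 'I_n -> loc_mod M m),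
      eval u (map_term (scalar_at hm) (e k)) = linform (loc_of m \o (r0 \o inl)) u.
  have h k : exists e : term (scalar_over (D k)) 'I_n,
      forall m (hm : D k m) (u : 'I_n -> loc_mod M m),
      eval u (map_term (scalar_at hm) e) = linform (loc_of m \o (r0 \o inl)) u.
    by apply: linform_term => m /DC Cm i; exact: hs.
  by exists (fun k => sval (cid (h k))) => k; exact: (svalP (cid (h k))).
have [d hd] : exists d : forall k, index_over (D k),
    forall k m (hm : D k m) (x : loc_mod M m),
    V_loc (index_at hm (d k)) x <-> exists y, x = loc_of m (r0 (inr j)) *: y.
  have h k : exists d : index_over (D k),
      forall m (hm : D k m) (x : loc_mod M m),
      V_loc (index_at hm d) x <-> exists y, x = loc_of m (r0 (inr j)) *: y.
    by apply: divisibility_index => // m /DC Cm; exact: hs.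
  by exists (fun k => sval (cid (h k))) => k; exact: (svalP (cid (h k))).
exists K, D, (fun k => AV (d k) (e k) :: psi k); split=> // k m hm u.
have Cm := DC k m hm.
rewrite (loc_solvable_pivot (C := C) (j := j) u (hs m Cm) r0s); last first.
  by case: (hD k) => _; apply.
by rewrite /= hd he -hpsi.
Qed.

(** Induction on the number of rows, as elimination removes the pivot row. The finitely many pivot
    sets cover [C], since at every point some nonzero coefficient of an unknown has least
    valuation. *)
Lemma loc_systems_resolvable C (s : seq row) : constructible C ->
  (forall m, C m -> forall r, r \in s -> forall i, r i \in loc_frac m) ->
  resolvable C s.
Proof.
have [N] := ubnP (size s); elim: N s C => // N IH s C szs hC hs.
have [/hasP[r1 r1s /existsP[j1 r1j1]]|s0] :=
  boolP (has (fun r : row => [exists j, r (inr j) != 0]) s); last first.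
  apply: resolvable_equations => // r rs j; apply/eqP.
  by apply: contraNT s0 => rj; apply/hasP; exists r => //; apply/existsP; exists j.
pose D (i : seq_sub s * X) := pivot_set C s (val i.1) i.2.
apply: (@resolvable_cover _ C D) => [i m /pivot_setP[]//|m Cm|[[r0 r0s] j]].
  have [|q [qs q0 qdiv]] := @exists_min_valuation _ m hB
      [seq (r : row) (inr k) | r <- s, k <- enum X].
    apply/hasP; exists (r1 (inr j1)) => //.
    by apply/allpairsP; exists (r1, j1); rewrite mem_enum.
  move: qs => /allpairsP[[r k] /= [rs _ Eq]].
  exists (SeqSub rs, k); apply/pivot_setP; rewrite /= -Eq; split=> // r' k' r's.
  by apply: qdiv; apply/allpairsP; exists (r', k'); rewrite mem_enum.
apply: (resolvable_pivot r0s hs); apply: IH.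
- rewrite size_map size_rem //; move: r0s szs; by case: (s).
- exact: constructible_pivot_set.
(* Integrality survives elimination: the only quotients that enter are by the pivot, and these are
   integral on the pivot set. *)
move=> m /pivot_setP[_ Cm hdiv] _ /mapP[r /mem_rem rs ->] i; rewrite ffunE.
by apply: rpredB; [|apply: rpredM]; [exact: hs | exact: hdiv | exact: hs].
Qed.

End Resolution.
End LocalSystems.

(** * Passage between [M] and its localizations *)

Section LocalGlobal.
Variables (B : idomainType) (M : lmodType B).

Lemma to_locD (m : MSpec B) : {morph @to_loc B M m : x y / x + y}.
Proof.
move=> x y; rewrite /to_loc mkfracD; apply: mkfracE.
by rewrite !scale1r mul1r scale1r.
Qed.

Lemma to_loc0 (m : MSpec B) : to_loc m (0 : M) = 0.
Proof. by []. Qed.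

Lemma loc_of_tofrac (m : MSpec B) a : loc_val (loc_of m a%:F) = a%:F / 1%:F.
Proof. by rewrite loc_ofK ?tofrac_loc // tofrac1 divr1. Qed.

Lemma to_locZ (m : MSpec B) a (x : M) :
  to_loc m (a *: x) = loc_of m a%:F *: to_loc m x.
Proof.
rewrite -[RHS]/(loc_scale _ _) /to_loc.
rewrite (loc_scaleE (mspec_one m) _ _ (loc_of_tofrac m a)); apply: mkfracE.
by rewrite mul1r.
Qed.

Lemma to_loc_linform (m : MSpec B) (I : finType) (f : I -> B) (e : I -> M) :
  to_loc m (linform f e) =
  linform (fun i => loc_of m (f i)%:F) (fun i => to_loc m (e i)).
Proof.
rewrite /linform (big_morph _ (@to_locD m) (@to_loc0 m)).
by apply: eq_bigr => i _; exact: to_locZ.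
Qed.

Lemma to_loc_eq0 (m : MSpec B) (x : M) :
  to_loc m x = 0 -> exists2 p, p \notin m & p *: x = 0.
Proof.
move/mkfracP => [p pm]; rewrite scaler0 mulr1 => px.
by exists p.
Qed.

Lemma clear_denominator (m : MSpec B) (z : loc_mod M m) :
  exists s (x : M), s \notin m /\ loc_of m s%:F *: z = to_loc m x.
Proof.
elim/mkfrac_ind: z => x s sm; exists s, x; split=> //.
rewrite -[LHS]/(loc_scale _ _) (loc_scaleE (mspec_one m) _ _ (loc_of_tofrac m s)).
by apply: mkfracE; rewrite mul1r scale1r.
Qed.

Lemma clear_denominators (m : MSpec B) (X : finType) (z : X -> loc_mod M m) :
  exists s (x : X -> M), s \notin m /\
    forall j, loc_of m s%:F *: z j = to_loc m (x j).
Proof.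
have /choice[s /choice[x hx]] := fun j => clear_denominator (z j).
(* The common denominator is the product of all [s j]; each numerator is multiplied by the remaining
   factors. *)
exists (\prod_j s j), (fun j => (\prod_(k | k != j) s k) *: x j); split.
  apply: (big_ind (fun p => p \notin m)); first exact: mspec_one.
    exact: mspec_mul.
  by move=> j _; case: (hx j).
move=> j; rewrite (bigD1 j) //= mulrC tofracM loc_ofM ?tofrac_loc //.
by rewrite -scalerA to_locZ; case: (hx j) => _ ->.
Qed.

Lemma common_annihilator (m : MSpec B) (T : eqType) (s : seq T) (y : T -> M) :
  (forall t, t \in s -> to_loc m (y t) = 0) ->
  exists2 p, p \notin m & forall t, t \in s -> p *: y t = 0.
Proof.
elim: s => [|t s IH] h; first by exists 1; rewrite ?mspec_one.
have [p pm ht] := to_loc_eq0 (h t (mem_head t s)).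
have [|q qm hs] := IH; first by move=> t' t's; apply: h; rewrite inE t's orbT.
exists (p * q); first exact: mspec_mul.
move=> t'; rewrite inE => /predU1P[->|/hs E]; last by rewrite -scalerA E scaler0.
by rewrite mulrC -scalerA ht scaler0.
Qed.

(* The multipliers [p] for which the system with right-hand side scaled by [p]
   is solvable form an ideal, which no maximal ideal contains. *)
Lemma solvable_system_local_global (T : eqType) (Y X : finType) (s : seq T)
    (f : T -> Y + X -> B) (u : Y -> M) :
  solvable_system s f u <->
  forall m : MSpec B,
    solvable_system s (fun t i => loc_of m (f t i)%:F) (fun i => to_loc m (u i)).
Proof.
have jE m x i : join (fun i => to_loc m (u i)) (fun j => to_loc m (x j)) i =
    to_loc m (join u x i) by case: i.
split.
  move=> [x hx] m; exists (fun j => to_loc m (x j)) => t ts.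
  rewrite /linform; under eq_bigr do rewrite jE.
  by rewrite -[LHS](to_loc_linform m) hx.
move=> hloc.
pose J p := exists x : X -> M, forall t, t \in s ->
  p *: linform (f t \o inl) u + linform (f t \o inr) x = 0.
have [[x hx]|J1] := pselect (J 1).
  by exists x => t ts; rewrite linform_join -[X in X + _]scale1r hx.
have [| |m hm] := @maximal_ideal_exists B J _ J1.
- exists (fun=> 0) => t _; rewrite scale0r add0r.
  by apply: big1 => j _; rewrite scaler0.
- move=> a p q [x hx] [y hy]; exists (fun j => a *: x j + y j) => t ts.
  rewrite linform_lin scalerDl addrACA -scalerA -scalerDr hx // hy //.
  by rewrite scaler0 addr0.
(* Scaling the local solution by [q] brings it into the image of [M]. The system scaled by [q] then
   holds up to errors that vanish at [m], and [p] kills these; hence [p * q] lies in [J] but not in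
   [m]. *)
have [z hz] := hloc m; have [q [x [qm hx]]] := clear_denominators z.
have [|p pm hp] := @common_annihilator m _ s
    (fun t => q *: linform (f t \o inl) u + linform (f t \o inr) x).
  move=> t ts; rewrite to_locD to_locZ !to_loc_linform.
  have -> : linform (fun i => loc_of m ((f t \o inr) i)%:F)
      (fun j => to_loc m (x j)) =
      loc_of m q%:F *: linform (fun i => loc_of m ((f t \o inr) i)%:F) z.
    rewrite /linform scaler_sumr; apply: eq_bigr => j _.
    by rewrite -hx !scalerA mulrC.
  rewrite -scalerDr (_ : _ + _ = 0) ?scaler0 //.
  by have := hz t ts; rewrite linform_join.
have /negP := mspec_mul pm qm; case; apply: hm.
exists (fun j => p *: x j + 0) => t ts; rewrite linform_lin -scalerA.
rewrite [X in _ + (_ + X)]big1 ?addr0; last by move=> j _; rewrite scaler0.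
by rewrite -scalerDr hp.
Qed.

(** * Translation of pp formulas into linear systems *)

Section Formulas.
Variables (V : GammaBPos B -> set M) (hV : T_V_div V).

(** Multiples of an integral representative [a] satisfy the predicate because every element
    satisfies the one of index [1] and [TV_scale] multiplies the index; [TV_div] is the converse. *)
Lemma V_divisible d : exists a : B, forall x, V d x <-> exists y, x = a *: y.
Proof.
case: (svalP d) => _ [/asboolP[a ->] a0 Ed].
have aN0 : a != 0 by rewrite -tofrac_eq0.
have -> : d = vB aN0 by case: d Ed => d dp /= Ed; apply: eq_exist; exact: gsetI.
exists a => x; split=> [/(TV_div hV)[y <-]|[y ->]]; first by exists y.
have := TV_scale hV aN0 (TV_one hV y).
suff -> : gmulp (gone (int_frac B)) (vB aN0) = vB aN0 by [].
by apply: eq_exist; apply: gsetI; rewrite /= ucoset_mul mul1r.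
Qed.

Lemma eval_linform (Z : finType) (t : term B Z) :
  exists f : Z -> B, forall e : Z -> M, eval e t = linform f e.
Proof.
elim: t => [z||t1 [f1 h1] t2 [f2 h2]|t [f h]|r t [f h]].
- exists (fun i => (i == z)%:R) => e; rewrite /linform (bigD1 z) //= eqxx scale1r.
  by rewrite big1 ?addr0 // => i /negPf ->; rewrite scale0r.
- by exists (fun=> 0) => e; rewrite /linform big1 // => i _; rewrite scale0r.
- exists (fun i => f1 i + f2 i) => e; rewrite /= h1 h2 -big_split.
  by apply: eq_bigr => i _; rewrite scalerDl.
- exists (fun i => - f i) => e; rewrite /= h -sumrN.
  by apply: eq_bigr => i _; rewrite scaleNr.
- by exists (fun i => r * f i) => e; rewrite /= h linformZ.
Qed.

(** An equation counts as divisibility by [0] of the difference of its sides, so both kinds of atoms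
    take one form. *)
Lemma sat_atomic_divisible (Z : finType) (a : atomic B (GammaBPos B) Z) :
  exists (f : Z -> B) (c : B), forall e : Z -> M,
    sat_atomic V e a <-> exists y, linform f e = c *: y.
Proof.
case: a => [t1 t2|d t].
  have [f1 h1] := eval_linform t1; have [f2 h2] := eval_linform t2.
  exists (fun i => f1 i - 1 * f2 i), 0 => e; rewrite /= h1 h2 linformB scale1r.
  split=> [->|[y /eqP]]; first by exists 0; rewrite subrr scaler0.
  by rewrite scale0r subr_eq0 => /eqP.
have [f h] := eval_linform t; have [c hc] := V_divisible d.
by exists f, c => e; rewrite /= h.
Qed.

Lemma sat_conj_divisible (Z : finType) (s : conjunction B (GammaBPos B) Z) :
  exists (K : finType) (f : K -> Z -> B) (c : K -> B), forall e : Z -> M,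
    sat_conj V e s <-> forall k, exists y, linform (f k) e = c k *: y.
Proof.
elim: s => [|a s [K [f [c h]]]].
  by exists void, (fun=> fun=> 0), (fun=> 0) => e; split=> // _ [].
have [f0 [c0 h0]] := sat_atomic_divisible a.
exists (option K), (fun o => if o is Some k then f k else f0),
  (fun o => if o is Some k then c k else c0) => e; rewrite /= h0 h.
split=> [[ha hs] [k|]|hk] //.
by split=> [|k]; [exact: (hk None) | exact: (hk (Some k))].
Qed.

(** A divisibility becomes an equation once its quotient is counted as an unknown; the unknowns are
    thus the bound variables and one quotient per divisibility. *)
Lemma sat_pp_system n (phi : pp_formula B (GammaBPos B) n) :
  exists (K X : finType) (f : K -> 'I_n + X -> B), forall u : 'I_n -> M,
    sat_pp V phi u <-> solvable_system (enum K) f u.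
Proof.
have [K [f [c h]]] := sat_conj_divisible (pp_matrix phi).
pose g k (z : 'I_n + ('I_(pp_bound phi) + K)) : B := match z with
  | inl i => f k (inl i)
  | inr (inl j) => f k (inr j)
  | inr (inr k') => - (c k *+ (k' == k))
  end.
exists K, ('I_(pp_bound phi) + K)%type, g => u.
have gE k w : linform (g k) (join u w) =
    linform (f k) (join u (w \o inl)) - c k *: w (inr k).
  rewrite !linform_join -addrA; congr (_ + _).
  rewrite [LHS]big_sumType; congr (_ + _) => /=.
  rewrite (bigD1 k) //= eqxx scaleNr big1 ?addr0 // => k' /negPf ->.
  by rewrite mulr0n oppr0 scale0r.
split.
  move=> [x /h /choice[y hy]]; exists (join x y) => k _.
  by rewrite gE; apply/eqP; rewrite subr_eq0; apply/eqP; exact: hy.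
move=> [w hw]; exists (w \o inl); apply/h => k; exists (w (inr k)).
by apply/eqP; rewrite -subr_eq0 -gE hw ?mem_enum.
Qed.

End Formulas.
End LocalGlobal.

Theorem theorem5p6 (B : idomainType) (hB : bezout_domain B) (M : lmodType B)
    (V : GammaBPos B -> set M) (hV : T_V_div V)
    (n : nat) (phi : pp_formula B (GammaBPos B) n) :
  exists (K : finType) (C : K -> set (MSpec B)) (psi : forall k, conj_over (C k) n),
    [/\ (forall k, constructible (C k)),
        (forall m : MSpec B, exists k, C k m) &
        forall u : 'I_n -> M,
          sat_pp V phi u <->
          (forall (k : K) (m : MSpec B) (hm : C k m),
            sat_conj (@V_loc B M m) (fun i => to_loc m (u i))
                     (conj_at hm (psi k)))].
Proof.
have [T [X [f hf]]] := sat_pp_system hV phi.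
pose row t : {ffun 'I_n + X -> {fraction B}} := [ffun i => (f t i)%:F].
(* The entries come from [B], hence are integral at every maximal ideal, and elimination can start
   from the whole space. *)
have [||K [C [psi [hC cov hpsi]]]] :=
  @loc_systems_resolvable B M hB n X setT [seq row t | t <- enum T].
- exact: constructibleT.
- by move=> m _ _ /mapP[t _ ->] i; rewrite ffunE tofrac_loc.
exists K, C, psi; split=> [k|m|u]; [by case: (hC k) | exact: cov |].
have rowE m (x : 'I_n + X -> loc_mod M m) t : linform (loc_of m \o row t) x =
    linform (fun i => loc_of m (f t i)%:F) x.
  by apply: eq_bigr => i _; rewrite /= ffunE.
have locE m (w : 'I_n -> loc_mod M m) :
    loc_solvable [seq row t | t <- enum T] w <->
    solvable_system (enum T) (fun t i => loc_of m (f t i)%:F) w.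
  split=> -[x hx]; exists x.
    by move=> t tT; rewrite -rowE; apply: hx; exact: map_f.
  by move=> _ /mapP[t tT ->]; rewrite rowE; exact: hx.
rewrite hf solvable_system_local_global; split=> h.
  by move=> k m hm; apply/hpsi/locE.
(* Solvability at [m] may be tested on any piece containing [m]; the covering supplies one. *)
by move=> m; apply/locE; have [k hm] := cov m I; apply/(hpsi k m hm); exact: h.
Qed.
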